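(* There exists $X\subseteq\beta\omega$ of cardinality $2^{\mathfrak c}$ such that $\omega\subseteq X$, $X^\kappa$ is $n$-cascade countably compact for every cardinal $\kappa<\mathfrak h$ and every $n\in\omega$, and $\exp X$ is not pseudocompact. In particular, $X^\omega$ is $n$-cascade countably compact for every $n\in\omega$.
   Context: $\mathfrak c=2^{\aleph_0}$. $\beta\omega$ is the Stone–Čech compactification of the discrete space $\omega$, whose points are identified with the ultrafilters on $\omega$. $\mathfrak h$ is the distributivity number: the least cardinality of a family of $\subseteq^*$-dense, $\subseteq^*$-downward closed subsets of $[\omega]^\omega$ (the infinite subsets of $\omega$) whose intersection is empty. For a $T_1$ space $(X,\tau)$, $\exp X$ is the set of non-empty closed subsets of $X$ with the Vietoris topology, generated by the subbase of all sets $U^+=\{F\in\exp X:F\subseteq U\}$ and $U^-=\{F\in\exp X:F\cap U\neq\emptyset\}$, $U\in\tau$. A space is pseudocompact if every continuous real-valued function on it is bounded. For infinite $M\subseteq\omega$ and $n\in\omega$, $[M]^n$ is the set of $n$-element subsets of $M$ (so $[M]^0=\{\emptyset\}$). If $p$ is a free ultrafilter on $\omega$, $A\in p$ and $(x_m:m\in A)$ is a family in a topological space $Y$, then $x\in Y$ is a $p$-limit of it if $\{m\in A:x_m\in U\}\in p$ for every neighborhood $U$ of $x$. Cascade limits: let $Y$ be a topological space, $p$ a free ultrafilter on $\omega$ with $M\in p$, and $f$ a function into $Y$ whose domain contains $[M]^n$. Recursively on $n$, $x\in Y$ is an $[M]^n$-cascade $p$-limit point of $f$ if: for $n=0$, $f(\emptyset)=x$;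 for $n>0$, there exist $A\in p$ with $A\subseteq M$ and a family $(x_m:m\in A)$ in $Y$ such that for every $m\in A$, $x_m$ is an $[M\setminus(m+1)]^{n-1}$-cascade $p$-limit point of $f_m:[M\setminus(m+1)]^{n-1}\to Y$, $f_m(s)=f(\{m\}\cup s)$, and $x$ is a $p$-limit of $(x_m:m\in A)$. (Here $m+1=\{0,\dots,m\}$.) $Y$ is $n$-cascade countably compact if for every $f:[\omega]^n\to Y$ there is a free ultrafilter $p$ on $\omega$ such that $f$ has an $[\omega]^n$-cascade $p$-limit point in $Y$. *)

(* Defs.v *)
From HB Require Import structures.
From mathcomp Require Import all_boot all_order all_algebra finmap.
From mathcomp Require Import all_classical.
From mathcomp Require Import reals topology normedtype.
Import numFieldNormedType.Exports.

Set Implicit Arguments.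
Unset Strict Implicit.
Unset Printing Implicit Defensive.

Local Open Scope classical_set_scope.
Local Open Scope card_scope.

Definition card_lt T U (A : set T) (B : set U) : Prop :=
  A #<= B /\ ~ (B #<= A).

(** The Stone-Cech compactification of the discrete space [nat]: the space of
    ultrafilters on [nat], with the Stone topology *)
Record betaN := BetaN {
  betaN_filter : set_system nat ;
  betaN_ultra : UltraFilter betaN_filter }.

HB.instance Definition _ := gen_eqMixin betaN.
HB.instance Definition _ := gen_choiceMixin betaN.

Definition stone_open (A : set nat) : set betaN := [set p : betaN | betaN_filter p A].

Lemma stone_open_cover : \bigcup_(A in [set: set nat]) stone_open A = setT.
Proof.
apply/seteqP; split=> // p _; exists setT => //.
have := betaN_ultra p => pU; exact: filterT.
Qed.

Lemma stone_open_join (A B : set nat) (p : betaN) :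
  [set: set nat] A -> [set: set nat] B -> stone_open A p -> stone_open B p ->
  exists C : set nat, [/\ [set: set nat] C, stone_open C p &
    stone_open C `<=` stone_open A `&` stone_open B].
Proof.
move=> _ _ pA pB; exists (A `&` B); split=> //.
  by have := betaN_ultra p => pU; exact: filterI.
move=> q qAB; have := betaN_ultra q => qU.
by split; apply: filterS qAB => n [].
Qed.

HB.instance Definition _ :=
  isBaseTopological.Build betaN stone_open_cover stone_open_join.

Definition betaN_of_nat (n : nat) : betaN := BetaN (principal_filter_ultra n).

Definition almost_subset (A B : set nat) : Prop := finite_set (A `\` B).

Definition dense_downclosed (D : set (set nat)) : Prop :=
  [/\ (forall A, D A -> infinite_set A),
      (forall A, infinite_set A -> exists2 B, D B & almost_subset B A) &
      (forall A B, D B -> infinite_set A -> almost_subset A B -> D A)].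

Definition non_distributive (F : set (set (set nat))) : Prop :=
  (forall D, F D -> dense_downclosed D) /\ \bigcap_(D in F) D = set0.

Definition least_card T (C : set (set T)) (F : set T) : Prop :=
  C F /\ forall G, C G -> F #<= G.

(** A cardinal is represented by a set of that cardinality; here it is a
    non-distributive family of least cardinality, which exists by
    [distributivity_numberP]. *)
Definition distributivity_number : set (set (set nat)) :=
  get (least_card non_distributive).

Lemma least_card_exists (T : choiceType) (C : set (set T)) :
  C !=set0 -> exists F, least_card C F.
Proof.
move=> [F1 CF1].
have [[F0 CF0 F00]|noempty] := pselect (exists2 F, C F & F = set0).
  by exists F0; split=> // G _; rewrite F00 card_ge0.
pose P (H : set (set T -> T)) :=
  (forall g, H g -> forall F, C F -> F (g F)) /\
  (forall g h, H g -> H h -> forall F, C F -> g F = h F -> g = h).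
have [K KP Ktot|H [[H1 H2] Hmax]] := @Zorn_bigcup _ P.
  split=> [g [L KL Lg] F CF|g h [L KL Lg] [M KM Mh] F CF gh].
    by have [P1 _] := KP _ KL; exact: (P1 _ Lg _ CF).
  have [LM|ML] := Ktot _ _ KL KM.
    by have [_ P2] := KP _ KM; exact: (P2 _ _ (LM _ Lg) Mh _ CF).
  by have [_ P2] := KP _ KL; exact: (P2 _ _ Lg (ML _ Mh) _ CF).
have [F CF Fsurj] :
    exists2 F, C F & forall x, F x -> exists2 g, H g & g F = x.
  apply: contrapT => noF.
  have pick F : exists x, C F -> F x /\ forall g, H g -> g F <> x.
    have [CF|nCF] := pselect (C F); last first.
      have [x _] : F1 !=set0.
        by apply/set0P/eqP => F10; apply: noempty; exists F1.
      by exists x.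
    apply: contrapT => nx; apply: noF; exists F => // x Fx.
    apply: contrapT => ng; apply: nx; exists x => _; split=> // g Hg gx.
    by apply: ng; exists g.
  have [g0 g0P] := choice pick.
  apply: (Hmax (H `|` [set g0])).
    rewrite properEneq; split; last exact: subsetUl.
    apply/eqP => HE; have Hg0 : H g0 by rewrite HE; right.
    by have [_ /(_ _ Hg0)] := g0P _ CF1.
  split=> [g [Hg|->] F CF|g h [Hg|->] [Hh|->] F CF gh//].
  - exact: (H1 _ Hg _ CF).
  - by have [] := g0P _ CF.
  - exact: (H2 _ _ Hg Hh _ CF gh).
  - by have [_ /(_ _ Hg)] := g0P _ CF.
  - by have [_ /(_ _ Hh)] := g0P _ CF; rewrite gh.
exists F; split=> // G CG.
have pick x : exists g, F x -> H g /\ g F = x.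
  have [Fx|nFx] := pselect (F x); last by exists (fun=> x).
  by have [g Hg gx] := Fsurj _ Fx; exists g.
have [s sP] := choice pick.
suff [f [fun_f inj_f]] : exists f : T -> T,
    set_fun F G f /\ {in F &, injective f}.
  by rewrite -(card_le_eql (inj_card_eq inj_f)) subset_card_le// => _ [x Fx <-];
    exact: fun_f.
exists (fun x => s x G); split=> [x Fx|x y /set_mem Fx /set_mem Fy /= sxy].
  by have [Hs _] := sP _ Fx; exact: (H1 _ Hs _ CG).
have [Hx ex] := sP _ Fx; have [Hy ey] := sP _ Fy.
by rewrite -ex -ey (H2 _ _ Hx Hy _ CG sxy).
Qed.

Lemma infinite_set_split (A : set nat) : infinite_set A ->
  exists B, [/\ B `<=` A, infinite_set B & infinite_set (A `\` B)].
Proof.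
move=> /infiniteP/ppcard_leP[f].
have finj : injective f by move=> x y; apply: 'inj_f; rewrite inE.
have fA n : A (f n) by exact: funS.
have infE (g : nat -> nat) : injective g -> infinite_set (range (f \o g)).
  move=> ginj; apply/infiniteP; rewrite (card_le_eqr (inj_card_eq _))//.
  by move=> x y _ _ /finj/ginj.
exists (range (f \o double)); split.
- by move=> _ [n _ <-]; exact: fA.
- by apply: infE => x y /double_inj.
apply: (@sub_infinite_set _ (range (f \o (fun n => n.*2.+1)))).
  move=> _ [n _ <-]; split=> [|[m _ /finj /(congr1 odd)]]; first exact: fA.
  by rewrite /= !odd_double.
by apply: infE => x y [/double_inj].
Qed.

Lemma distributivity_numberP :
  least_card non_distributive distributivity_number.
Proof.
apply: getPex; apply: least_card_exists.
pose D (A : set nat) := [set B | infinite_set B /\ ~ almost_subset A B].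
exists [set D A | A in [set A | infinite_set A]]; split; last first.
  apply/seteqP; split=> // B HB.
  have [A0 infA0] : exists A : set nat, infinite_set A.
    by exists setT; exact: infinite_nat.
  have [infB _] : D A0 B by apply: HB; exists A0.
  have [_ []] : D B B by apply: HB; exists B.
  by rewrite /almost_subset setDv; exact: finite_set0.
move=> _ [A infA <-]; split=> [B []//|B infB|B' B [infB nAB] infB' B'B].
  have [AB|nAB] := pselect (almost_subset A B); last first.
    by exists B; [split|rewrite /almost_subset setDv; exact: finite_set0].
  have infAB : infinite_set (A `&` B).
    by move=> fAB; apply: infA; rewrite -(setUIDK A B) finite_setU.
  have [E [EAB infE infABE]] := infinite_set_split infAB.
  exists E; last first.
    rewrite /almost_subset; suff -> : E `\` B = set0 by exact: finite_set0.
    by apply/seteqP; split=> // x [/EAB[]].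
  split=> // AE; apply: infABE; apply: sub_finite_set AE.
  by move=> x [[Ax _] nEx].
split=> // AB'; apply: nAB.
apply: (@sub_finite_set _ _ ((A `\` B') `|` (B' `\` B))).
  move=> x [Ax nBx]; have [B'x|nB'x] := pselect (B' x); first by right.
  by left.
by rewrite finite_setU.
Qed.

Record hyperspace (X : topologicalType) := Hyperspace {
  hyperset :> set X ;
  hyperset_closed : closed hyperset ;
  hyperset_nonempty : hyperset !=set0 }.

Section vietoris.
Variable X : topologicalType.

HB.instance Definition _ := gen_eqMixin (hyperspace X).
HB.instance Definition _ := gen_choiceMixin (hyperspace X).

Definition vietoris_upper (U : set X) : set (hyperspace X) :=
  [set F : hyperspace X | F `<=` U].

Definition vietoris_lower (U : set X) : set (hyperspace X) :=
  [set F : hyperspace X | F `&` U !=set0].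

Definition vietoris_subbase : set (set (hyperspace X)) :=
  [set vietoris_upper U | U in @open X] `|`
  [set vietoris_lower U | U in @open X].

HB.instance Definition _ :=
  isSubBaseTopological.Build (hyperspace X) vietoris_subbase id.

End vietoris.

Definition pseudocompact (R : realType) (X : topologicalType) : Prop :=
  forall f : X -> R, continuous f -> bounded_fun f.

Definition free_ultrafilter (p : set_system nat) : Prop :=
  UltraFilter p /\ \bigcap_(A in p) A = set0.

Definition is_plimit (Y : topologicalType) (p : set_system nat) (A : set nat)
    (u : nat -> Y) (x : Y) : Prop :=
  forall U, nbhs x U -> p [set m | A m /\ U (u m)].

(** Families indexed by [A] and functions on the [n]-element subsets of [M]
    are represented by total functions on [nat] and on [{fset nat}]: only
    the values at the elements of [A], resp. at the [n]-element subsets of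
    [M], are used. *)
Fixpoint cascade_plimit (Y : topologicalType) (p : set_system nat) (n : nat)
    (M : set nat) (f : {fset nat} -> Y) (x : Y) : Prop :=
  match n with
  | 0 => f fset0 = x
  | n'.+1 => exists (A : set nat) (u : nat -> Y),
      [/\ p A, A `<=` M,
          (forall m, A m ->
             cascade_plimit p n' (M `\` [set k | (k < m.+1)%N])
               (fun s => f (m |` s)%fset) (u m)) &
          is_plimit p A u x]
  end.

Definition cascade_countably_compact (n : nat) (Y : topologicalType) : Prop :=
  forall f : {fset nat} -> Y, exists p, free_ultrafilter p /\
    exists x, cascade_plimit p n setT f x.

(* Main.v *)
Require Import Defs.
From mathcomp Require Import all_boot all_order all_algebra finmap.
From mathcomp Require Import all_classical.
From mathcomp Require Import reals topology normedtype.
Import numFieldNormedType.Exports.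

Set Implicit Arguments.
Unset Strict Implicit.
Unset Printing Implicit Defensive.

Local Open Scope classical_set_scope.
Local Open Scope card_scope.

(** Fix disjoint finite blocks of naturals, the [n]-th one consisting of the codes
    of the boolean words of length [n], and let [block] send each code to the
    index of its block.  Each [x : set nat] selects one point
    [selection x n] in every block, namely its own initial word, and two
    different sets select different points in almost all blocks.  Choose, for
    every free ultrafilter [P], a set [xi P], and let [X] omit exactly the
    ultrafilters [selection (xi P) (P)], [P] free: one point in each fibre of
    the extension of [block] over a free ultrafilter ([selective_set]).

    Whatever [xi] is, the hyperspace of such an [X] is not pseudocompact: the
    function equal to [n] on the closed sets that fill the [n]-th block and
    equal to 0 elsewhere is locally constant.  Indeed a closed set [L] near
    which infinitely many blocks are filled would lie in one fibre, over a free
    [P]; as [X] misses the point of that fibre given by [selection (xi P)], [L]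
    has a neighbourhood of sets avoiding the graph of this selection, and no
    such set fills a block.

    The work is to choose [xi] so that the powers of [X] have cascade limits.
    An iterated limit along [q] of a function [f] on [k]-element sets is one
    limit along the power ultrafilter of [q] on finite sets, so it always
    exists in the space of all ultrafilters; the question is whether it falls
    out of [X].  Two ideas settle this.

    First, a fusion along an arbitrary free ultrafilter
    ([constant_or_readable]) shows that every infinite set contains an
    infinite [B] on whose [k]-element subsets [block (f s)] is either constant
    or allows an element of [s] to be read off, uniformly in [s].  Hence for
    every free [q] containing [B] either [block (f s)] is constant almost
    everywhere, or [q] is the image of [block (lim f)] under some map of [nat]
    ([stable_or_above]).  In the first case the limit cannot be the omitted
    point of its fibre, because that point is isolated in the fibre and the
    values of [f], being in [X], differ from it.  The sets with this property are dense and
    closed under almost inclusion, so if fewer than the distributivity number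
    of functions are given, one infinite set works for all of them and for all
    their sections ([distributive_tame]).

    Second, a transfinite recursion over all families [f] of functions
    ([selective_assignment]) handles the other case.  There are at most as many
    families as sets of sets of naturals, so they can be well-ordered with
    short initial segments, and as many ultrafilters contain a given infinite
    set; a diagonal argument in the style of Koenig ([koenig]) then picks for
    each family an ultrafilter [q] which is not an image of any ultrafilter
    [block p], [p] a limit point met before.  So each [block p] with [q] above
    it is met for the first time, and [xi (block p)] may still be chosen so as
    to avoid the limit points of this family, which are fewer than the
    continuum. *)

(** * Ultrafilters on the natural numbers *)

Lemma ultra_of_decide T (F : set_system T) :
  ProperFilter F -> (forall A, F A \/ F (~` A)) -> UltraFilter F.
Proof.
move=> PF dec; split=> // G PG FG; apply/seteqP; split=> // A GA.
case: (dec A) => // /FG GC; exfalso; apply: (@filter_not_empty _ G).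
by rewrite -(setICr A); exact: filterI.
Qed.

Lemma betaN_proper (q : betaN) : ProperFilter (betaN_filter q).
Proof. by have := betaN_ultra q => ?; exact: ultra_proper. Qed.
#[local] Hint Resolve betaN_proper : core.
#[local] Existing Instance betaN_ultra.

Lemma ultra_setC T (F : set_system T) (A : set T) :
  UltraFilter F -> ~ F A -> F (~` A).
Proof. by move=> FU; case: (in_ultra_setVsetC A FU). Qed.

Lemma filter_setC_not T (F : set_system T) (A : set T) :
  ProperFilter F -> F (~` A) -> ~ F A.
Proof.
move=> PF FC FA; apply: (@filter_not_empty _ F).
by rewrite -(setICr A); exact: filterI.
Qed.

Lemma ultra_le_eq T (F G : set_system T) :
  UltraFilter F -> ProperFilter G -> F `<=` G -> F = G.
Proof. by move=> FU PG FG; rewrite (max_filter PG FG). Qed.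

Lemma betaN_inj (p q : betaN) : betaN_filter p = betaN_filter q -> p = q.
Proof.
by case: p q => [p pU] [q qU] /= pq; subst q; congr BetaN; exact: Prop_irrelevance.
Qed.

Lemma betaN_le_eq (p q : betaN) :
  (forall A, betaN_filter p A -> betaN_filter q A) -> p = q.
Proof. by move=> pq; apply/betaN_inj/ultra_le_eq => //; exact: betaN_ultra. Qed.

Lemma betaN_sep (p q : betaN) : p <> q ->
  exists2 A, betaN_filter p A & ~ betaN_filter q A.
Proof.
move=> pq; apply: contrapT => nA; apply: pq; apply: betaN_le_eq => A pA.
by apply: contrapT => nqA; apply: nA; exists A.
Qed.

Lemma fmap_ultra T U (f : T -> U) (F : set_system T) :
  UltraFilter F -> UltraFilter (f @ F).
Proof.
move=> FU; apply: ultra_of_decide => A.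
exact: (in_ultra_setVsetC (f @^-1` A) FU).
Qed.

Definition bmap (f : nat -> nat) (q : betaN) : betaN :=
  BetaN (fmap_ultra f (betaN_ultra q)).

Lemma bmapE f q A : betaN_filter (bmap f q) A = betaN_filter q (f @^-1` A).
Proof. by []. Qed.

Definition limit_filter T (F : set_system T) (u : T -> betaN) : set_system nat :=
  [set Z | F [set t | betaN_filter (u t) Z]].

Lemma limit_filter_ultra T (F : set_system T) (u : T -> betaN) :
  UltraFilter F -> UltraFilter (limit_filter F u).
Proof.
move=> FU; apply: ultra_of_decide => [|A]; rewrite /limit_filter /=.
  split=> /=.
    move=> FE; apply: (@filter_not_empty _ F).
    by apply: filterS FE => t /= /filter_not_empty.
  split=> [|A B /= FA FB|A B AB /= FA] /=.
  - by apply: filterE => t /=; exact: filterT.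
  - by apply: filterS (filterI FA FB) => t [] /=; exact: filterI.
  - by apply: filterS FA => t /=; exact: filterS.
have [?|H] := in_ultra_setVsetC [set t | betaN_filter (u t) A] FU; first by left.
by right; apply: filterS H => t /= /ultra_setC; apply; exact: betaN_ultra.
Qed.

Definition blim T (F : set_system T) (FU : UltraFilter F) (u : T -> betaN) : betaN :=
  BetaN (limit_filter_ultra u FU).

Lemma blimE T (F : set_system T) (FU : UltraFilter F) (u : T -> betaN) Z :
  betaN_filter (blim FU u) Z = F [set t | betaN_filter (u t) Z].
Proof. by []. Qed.

Definition nonprincipal (q : betaN) : Prop := free_ultrafilter (betaN_filter q).

Lemma nonprincipal_coatom q k : nonprincipal q -> betaN_filter q [set m | m <> k].
Proof.
move=> [_ q0]; apply: contrapT => /(ultra_setC (betaN_ultra q)) qk.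
have : (\bigcap_(A in betaN_filter q) A) k; last by rewrite q0.
move=> A qA; apply: contrapT => nAk; apply: (@filter_not_empty _ (betaN_filter q)).
by apply: filterS (filterI qA qk) => m [Am /contrapT /= mk]; apply: nAk; rewrite -mk.
Qed.

Lemma nonprincipal_ge q k : nonprincipal q -> betaN_filter q [set m | (k <= m)%N].
Proof.
move=> qf; elim: k => [|k IH]; first by apply: filterE => m /=.
apply: filterS (filterI IH (nonprincipal_coatom k qf)) => m [/= km mk].
by rewrite ltn_neqAle km andbT; apply/eqP => /esym.
Qed.


Lemma principal_singleton q : ~ nonprincipal q -> exists n, betaN_filter q [set n].
Proof.
move=> nf; have [n qn] : exists n, (\bigcap_(A in betaN_filter q) A) n.
  apply/set0P/eqP => q0; apply: nf; split=> //; exact: betaN_ultra.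
exists n; apply: contrapT => /(ultra_setC (betaN_ultra q)) /qn.
exact.
Qed.

Lemma nonprincipal_infinite q A : nonprincipal q -> betaN_filter q A -> infinite_set A.
Proof.
move=> qf qA /finite_fsetP[F AF].
have qF : betaN_filter q [set m | ((\max_(i <- F) i).+1 <= m)%N] by exact: nonprincipal_ge.
apply: (@filter_not_empty _ (betaN_filter q)).
apply: filterS (filterI qA qF) => m []; rewrite AF /= => mF.
by apply/negP; rewrite -leqNgt; exact: leq_bigmax_seq.
Qed.

Lemma nonprincipal_cofinite q A : nonprincipal q -> finite_set (~` A) -> betaN_filter q A.
Proof.
move=> qf fA; apply: contrapT => /(ultra_setC (betaN_ultra q)).
by move=> /(nonprincipal_infinite qf); exact.
Qed.

Lemma nonprincipal_almost_subset q A B : nonprincipal q -> betaN_filter q A -> almost_subset A B ->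
  betaN_filter q B.
Proof.
move=> qf qA AB; have qD : betaN_filter q (~` (A `\` B)).
  by apply: nonprincipal_cofinite => //; rewrite setCK.
by apply: filterS (filterI qA qD) => m [Am nABm]; apply: contrapT => nB; apply: nABm.
Qed.

(** * Cascade limits as limits along power ultrafilters *)

Fixpoint power_filter (p : set_system nat) (n : nat) : set_system {fset nat} :=
  match n with
  | 0 => [set Q | Q fset0]
  | n'.+1 => [set Q | p [set m | power_filter p n' [set s | Q (m |` s)%fset]]]
  end.

Lemma power_filter_ultra p n : UltraFilter p -> UltraFilter (power_filter p n).
Proof.
move=> pU; elim: n => [|n IH].
  apply: ultra_of_decide => [|Q] /=; last exact: EM.
  by split=> //; split=> // A B AB; exact: AB.
apply: ultra_of_decide => [|Q]; rewrite /=.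
  split=> /=.
    move=> pE; apply: (@filter_not_empty _ p).
    by apply: filterS pE => t /= /filter_not_empty.
  split=> [|A B /= FA FB|A B AB /= FA] /=.
  - by apply: filterE => t /=; exact: filterT.
  - by apply: filterS (filterI FA FB) => t [] /=; exact: filterI.
  - by apply: filterS FA => t /=; apply: filterS => s; exact: AB.
have [?|H] := in_ultra_setVsetC [set m | power_filter p n [set s | Q (m |` s)%fset]] pU.
  by left.
by right; apply: filterS H => t /= /ultra_setC; apply.
Qed.

Definition clim (q : betaN) (n : nat) (f : {fset nat} -> betaN) : betaN :=
  blim (power_filter_ultra n (betaN_ultra q)) f.

Definition slice T (f : {fset nat} -> T) (m : nat) : {fset nat} -> T :=
  fun s => f (m |` s)%fset.

Lemma clim0 q f : clim q 0 f = f fset0.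
Proof. exact: betaN_le_eq. Qed.

Lemma climS q n f : clim q n.+1 f = blim (betaN_ultra q) (fun m => clim q n (slice f m)).
Proof. exact: betaN_le_eq. Qed.

Lemma power_filter_subsets (q : betaN) n (B : set nat) : nonprincipal q -> betaN_filter q B ->
  power_filter (betaN_filter q) n
    [set s | (forall k, k \in s -> B k) /\ #|` s|%fset = n].
Proof.
move=> qf; elim: n B => [|n IH] B qB /=; first by split=> //; rewrite cardfs0.
apply: filterS (qB) => m Bm /=.
have /IH : betaN_filter q (B `&` [set k | (m.+1 <= k)%N]).
  by apply: filterI => //; exact: (nonprincipal_ge m.+1 qf).
have ? := power_filter_ultra n (betaN_ultra q).
apply: filterS => s [sB sn] /=; split.
  by move=> k; rewrite !inE => /orP[/eqP->//|/sB[]].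
rewrite cardfsU1 sn; case: (boolP (m \in s)) => //= /sB[_] /=.
by rewrite ltnn.
Qed.

(** The clopen sets of ultrafilters form a base, and the topology of the power is
    generated by its coordinates. *)
Lemma cvg_ptws_val (I : Type) (X : set betaN) (F : set_system nat)
    (u : nat -> {ptws I -> set_type X}) (x : {ptws I -> set_type X}) :
  Filter F ->
  (forall i A, betaN_filter (val (x i)) A ->
     F [set m | betaN_filter (val (u m i)) A]) ->
  u @ F --> x.
Proof.
move=> FF H; apply/cvg_sup => i U [/= _ [[V /= oV <-] /= Vxi]] /filterS; apply.
move: oV Vxi => [W oW <-] /= Wxi.
rewrite openE in oW; have := oW _ Wxi.
rewrite /interior nbhsE => -[O [oO Ox OW]].
case: oO => D _ OE; move: Ox; rewrite -OE => -[A DA Ax].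
apply: (@filterS _ F _ [set m | betaN_filter (val (u m i)) A]); last exact: H.
by move=> m mA; apply: OW; rewrite -OE; exists A.
Qed.

(** All cascade limits exist among the ultrafilters and are computed coordinate
    by coordinate; what has to be checked is that the intermediate limits, which
    are the limits of the iterated sections of the coordinates, stay in [X]. *)
Lemma cascade_ptws (I : Type) (X : set betaN) (q : betaN) (n : nat) (M : set nat)
    (f : {fset nat} -> {ptws I -> set_type X}) :
  nonprincipal q -> betaN_filter q M ->
  (forall i ms k, (k + size ms)%N = n ->
     X (clim q k (foldl (@slice _) (fun s => val (f s i)) ms))) ->
  exists2 x, cascade_plimit (betaN_filter q) n M f x &
    forall i, val (x i) = clim q n (fun s => val (f s i)).
Proof.
move=> qf; elim: n M f => [|n IH] M f qM fX /=.
  by exists (f fset0) => // i; rewrite clim0.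
have stepX m : exists x, cascade_plimit (betaN_filter q) n (M `\` [set k | (k < m.+1)%N])
      (slice f m) x /\ forall i, val (x i) = clim q n (fun s => val (slice f m s i)).
  have [| |x xl xE] := IH (M `\` [set k | (k < m.+1)%N]) (slice f m).
  - apply: filterI => //; apply: filterS (nonprincipal_ge m.+1 qf) => k /=.
    by move=> mk; apply/negP; rewrite -leqNgt.
  - by move=> i ms k kn; apply: (fX i (m :: ms) k); rewrite /= addnS kn.
  by exists x.
have [u uP] := choice stepX.
have xX i : X (clim q n.+1 (fun s => val (f s i))) by apply: (fX i [::]); rewrite addn0.
pose x : {ptws I -> set_type X} := fun i =>
  exist _ (clim q n.+1 (fun s => val (f s i))) (mem_set (xX i)).
exists x => //.
exists M, u; split=> // [m _|U Ux]; first by have [] := uP m.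
apply: filterI => //.
suff : u @ betaN_filter q --> x by apply; exact: Ux.
apply: cvg_ptws_val => i A.
have -> : val (x i) = clim q n.+1 (fun s => val (f s i)) by [].
rewrite climS blimE; apply: filterS => m /=; by rewrite (uP m).2.
Qed.

(** * Fusion: constant or readable functions on finite sets *)

Lemma filter_seq_all T (J : eqType) (F : set_system T) (L : seq J) (P : J -> T -> Prop) :
  Filter F -> (forall j, j \in L -> F [set t | P j t]) ->
  F [set t | forall j, j \in L -> P j t].
Proof.
move=> FF; elim: L => [|j L IH] H.
  by apply: filterE => t j /=; rewrite in_nil.
have F1 : F [set t | P j t] by apply: H; rewrite mem_head.
have F2 : F [set t | forall j, j \in L -> P j t].
  by apply: IH => i iL; apply: H; rewrite inE iL orbT.
apply: filterS (filterI F1 F2) => t [Pj PL] i.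
by rewrite inE => /orP[/eqP->|/PL].
Qed.

Lemma betaN_sep_seq (q : betaN) (L : seq betaN) : exists Z, betaN_filter q Z /\
  forall p, p \in L -> p <> q -> ~ betaN_filter p Z.
Proof.
have sepP (p : betaN) : exists Z, betaN_filter q Z /\ (p <> q -> ~ betaN_filter p Z).
  have [->|pq] := pselect (p = q); first by exists setT; split=> //; exact: filterT.
  by have [Z qZ npZ] := betaN_sep (nesym pq); exists Z.
have [Z ZP] := choice sepP.
exists [set n | forall p, p \in L -> Z p n]; split.
  by apply: filter_seq_all => p _; exact: (ZP p).1.
move=> p pL pq pZ; apply: (ZP p).2 => //.
by apply: filterS pZ => n; apply.
Qed.

Definition below (N : nat) (u : {fset nat}) : {fset nat} := [fset k in u | (k < N)%N]%fset.

Lemma in_below N u k : (k \in below N u) = (k \in u) && (k < N)%N.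
Proof. by rewrite !inE. Qed.

Definition segment (B : set nat) (N : nat) : {fset nat} :=
  [fset k in iota 0 N | `[< B k >]]%fset.

Lemma in_segment B N k : (k \in segment B N) = (k < N)%N && `[< B k >].
Proof. by rewrite !inE mem_iota. Qed.

Lemma fset_bounded (u : {fset nat}) : exists N, forall k, k \in u -> (k < N)%N.
Proof.
exists (\max_(k <- u) k).+1 => k ku; rewrite ltnS.
exact: leq_bigmax_seq.
Qed.

(** The elements of [B] are picked greedily: each new one is taken from the set
    in [r] that keeps the finite approximation good. *)
Lemma diagonal_set (r : betaN) (A : set nat) (G : {fset nat} -> Prop) :
  nonprincipal r -> betaN_filter r A -> G fset0 ->
  (forall u, G u -> betaN_filter r [set m | G (m |` u)%fset]) ->
  exists B, [/\ B `<=` A, infinite_set B & forall N, G (segment B N)].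
Proof.
move=> rf rA G0 Gstep.
have stepP u : exists m, G u ->
    [/\ A m, (forall k, k \in u -> (k < m)%N) & G (m |` u)%fset].
  have [Gu|nGu] := pselect (G u); last by exists 0.
  have [N uN] := fset_bounded u.
  have [m [Am [/= Nm Gm]]] :=
    filter_ex (filterI rA (filterI (nonprincipal_ge N rf) (Gstep _ Gu))).
  exists m => _; split=> // k /uN kN.
  exact: leq_trans kN Nm.
have [h hP] := choice stepP.
pose U k := iter k (fun u => (h u |` u)%fset) fset0.
have GU k : G (U k).
  by elim: k => [//|k IH]; have [] := hP _ IH.
pose b k := h (U k).
have bA k : A (b k) by have [] := hP _ (GU k).
have bgt k j : j \in U k -> (j < b k)%N by have [_ + _] := hP _ (GU k); apply.
have US k : U k.+1 = (b k |` U k)%fset by [].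
have inU k j : j \in U k <-> exists2 i, (i < k)%N & j = b i.
  elim: k j => [|k IH] j; first by split=> [|[]]; rewrite ?inE.
  rewrite US !inE; split.
    move=> /orP[/eqP->|/IH[i ik ->]]; first by exists k.
    by exists i => //; exact: ltnW.
  move=> [i]; rewrite ltnS leq_eqVlt => /orP[/eqP->->|ik ->]; first by rewrite eqxx.
  by apply/orP; right; apply/IH; exists i.
have blt i k : (i < k)%N -> (b i < b k)%N by move=> ik; apply: bgt; apply/inU; exists i.
have bge k : (k <= b k)%N.
  by elim: k => // k IH; apply: leq_ltn_trans IH _; exact: blt.
exists (range b); split.
- by move=> _ [k _ <-].
- move=> /finite_fsetP[F FE]; have [N FN] := fset_bounded F.
  have : [set` F] (b N) by rewrite -FE; exists N.
  by move=> /= /FN; rewrite ltnNge bge.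
- move=> N; have exk : exists k, (N <= b k)%N by exists N.
  suff -> : segment (range b) N = U (ex_minn exk) by [].
  case: ex_minnP => k Nk kmin; apply/fsetP => j; rewrite in_segment.
  apply/andP/idP.
    move=> [jN /asboolP[i _ ij]]; apply/inU; exists i => //.
    rewrite ltnNge; apply/negP => ki; move: jN; rewrite -ij ltnNge => /negP; apply.
    move: ki; rewrite leq_eqVlt => /orP[/eqP <-//|/blt /ltnW].
    exact: leq_trans.
  move=> /inU[i ik ->]; split; last by apply/asboolP; exists i.
  by rewrite ltnNge; apply/negP => /kmin; rewrite leqNgt ik.
Qed.

Section fusion.
Variables (r : betaN) (rf : nonprincipal r) (n : nat).

(** [R] holds of almost all [n]-element end-extensions of [s], in the sense of
    [r]. *)
Definition forced (R : set {fset nat}) (s : {fset nat}) : Prop :=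
  power_filter (betaN_filter r) (n - #|` s|) [set t | R (s `|` t)%fset].

Lemma forced_full R s : #|` s|%fset = n -> forced R s <-> R s.
Proof. by move=> sn; rewrite /forced sn subnn /= fsetU0. Qed.

(** Whether [R] is forced is almost surely unchanged by adding a point, since an
    ultrafilter decides the sets of points for which it is. *)
Lemma forced_step R s : (#|` s|%fset < n)%N ->
  betaN_filter r [set m | m \notin s -> (forced R (m |` s)%fset <-> forced R s)].
Proof.
move=> sn; pose a := [set m | power_filter (betaN_filter r) (n - #|` s|).-1
  [set t | R ((m |` s) `|` t)%fset]].
have aE : betaN_filter r a = forced R s.
  rewrite /forced -[X in power_filter _ X](@prednK (n - #|` s|)) ?subn_gt0//=.
  congr (betaN_filter r _); apply/funext => m; rewrite /a /=.
  congr (power_filter _ _ _); apply/funext => t /=.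
  by rewrite fsetUCA fsetUA.
have am m : m \notin s -> a m = forced R (m |` s)%fset.
  by move=> ms; rewrite /forced cardfsU1 ms add1n subnS.
have [ra|nra] := pselect (betaN_filter r a).
  by apply: filterS (ra) => m Am ms; rewrite -am// -aE.
have := ultra_setC (betaN_ultra r) nra.
by apply: filterS => m Am ms; rewrite -am// -aE.
Qed.

Variable y : {fset nat} -> betaN.

Definition tail_lim (s : {fset nat}) : betaN :=
  clim r (n - #|` s|) (fun t => y (s `|` t)%fset).

Lemma tail_lim_full s : #|` s|%fset = n -> tail_lim s = y s.
Proof. by move=> sn; rewrite /tail_lim sn subnn clim0 fsetU0. Qed.

(** Let [y0] be the iterated limit of [y] along [r].  If almost all values of
    [y] equal [y0], a diagonal set makes them all equal.  Otherwise the partial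
    limits [tail_lim s'], [s'] running through the initial parts of [s], start
    at [y0] and end at [y s <> y0], so there is a first element [b] of [s] at
    which they leave [y0].  The fusion makes this [b] visible in [y s]: with
    every finite approximation [u] of [B] comes a set [Z u] of [y0] that belongs
    to no other partial limit over a subset of [u], and the next elements of [B]
    preserve all these memberships.  Then [phi m] is the first [N] such that [m]
    is not in the set attached to the elements of [B] up to [N]. *)
Lemma constant_or_readable A : betaN_filter r A ->
  exists B, [/\ B `<=` A, infinite_set B &
    (exists P, forall s, (forall k, k \in s -> B k) -> #|` s|%fset = n -> y s = P) \/
    (exists phi : nat -> nat, forall s, (forall k, k \in s -> B k) -> #|` s|%fset = n ->
       exists2 b, b \in s & betaN_filter (y s) [set m | phi m = b])].
Proof.
move=> rA; set y0 := tail_lim fset0.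
have ZP' u : exists Z, betaN_filter y0 Z /\
    forall s, (s `<=` u)%fset -> tail_lim s <> y0 -> ~ betaN_filter (tail_lim s) Z.
  have [Z [y0Z sZ]] := betaN_sep_seq y0 [seq tail_lim s | s <- enum_fset (fpowerset u)].
  exists Z; split=> // s su; apply: sZ; apply: map_f.
  by rewrite fpowersetE.
have [Z ZP] := choice ZP'.
have ZE u s : (s `<=` u)%fset -> betaN_filter (tail_lim s) (Z u) <-> tail_lim s = y0.
  move=> su; split=> [sZ|->]; last exact: (ZP u).1.
  by apply: contrapT => /((ZP u).2 _ su).
pose Q := [set t | y t = y0].
(* The invariant of the fusion: over subsets of [u], whether [y] equals [y0] is
   still forced as at the start, and the separators attached to the initial
   parts of [u] detect whether the corresponding partial limits equal [y0]. *)
pose G (u : {fset nat}) := forall s, (s `<=` u)%fset -> (#|` s| <= n)%N ->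
  (forced Q s <-> forced Q fset0) /\
  forall N, betaN_filter (tail_lim s) (Z (below N u)) <-> tail_lim (below N s) = y0.
have below0 N : below N fset0 = fset0 by apply/fsetP => k; rewrite in_below !inE.
have G0 : G fset0.
  move=> s; rewrite fsubset0 => /eqP -> _; split=> // N.
  by rewrite below0; exact: ZE.
have Gstep u : G u -> betaN_filter r [set m | G (m |` u)%fset].
  move=> Gu; have [M uM] := fset_bounded u.
  have E2 : betaN_filter r [set m | forall s, s \in enum_fset (fpowerset u) ->
      (#|` s|%fset < n)%N -> m \notin s -> (forced Q (m |` s)%fset <-> forced Q s) /\
      forall v, v \in enum_fset (fpowerset u) ->
        (betaN_filter (tail_lim (m |` s)%fset) (Z v) <->
         betaN_filter (tail_lim s) (Z v))].
    apply: filter_seq_all => s _.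
    have [sn|] := boolP (#|` s|%fset < n)%N; last by move=> _; exact: filterE.
    have E3 : betaN_filter r [set m | forall v, v \in enum_fset (fpowerset u) ->
        m \notin s -> (betaN_filter (tail_lim (m |` s)%fset) (Z v) <->
         betaN_filter (tail_lim s) (Z v))].
      by apply: filter_seq_all => v _; exact: (forced_step [set t | betaN_filter (y t) (Z v)] sn).
    apply: filterS (filterI (forced_step Q sn) E3) => m [H1 H2] _ ms.
    by split=> [|v vu]; [exact: H1|exact: H2].
  apply: filterS (filterI (nonprincipal_ge M rf) E2) => m [Mm H] s' s'u s'n.
  have um k : k \in u -> (k < m)%N by move=> /uM kM; exact: leq_trans kM Mm.
  have belowu N : (N <= m)%N -> below N (m |` u)%fset = below N u.
    move=> Nm; apply/fsetP => k; rewrite !in_below !inE.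
    by case: eqP => //= ->; rewrite ltnNge Nm andbF.
  have belowall (s : {fset nat}) N : (s `<=` m |` u)%fset -> (m < N)%N -> below N s = s.
    move=> /fsubsetP su mN; apply/fsetP => k; rewrite in_below.
    apply: andb_idr => /su; rewrite !inE => /orP[/eqP->//|/um km].
    exact: ltn_trans km mN.
  have late N : (m < N)%N -> betaN_filter (tail_lim s') (Z (below N (m |` u)%fset)) <->
      tail_lim (below N s') = y0.
    by move=> mN; rewrite !belowall//; exact: ZE.
  have [ms'|ms'] := boolP (m \in s'); last first.
    have s'u' : (s' `<=` u)%fset.
      apply/fsubsetP => k ks'; move/fsubsetP/(_ _ ks'): s'u; rewrite !inE.
      by case: eqP => [km|//]; rewrite km (negbTE ms') in ks'.
    have [QE ZZ] := Gu _ s'u' s'n; split=> // N.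
    by have [Nm|/late//] := leqP N m; rewrite belowu.
  pose s := (s' `\ m)%fset.
  have s'E : s' = (m |` s)%fset by rewrite /s fsetD1K.
  have ms : m \notin s by rewrite /s !inE eqxx.
  have su : (s `<=` u)%fset.
    apply/fsubsetP => k; rewrite /s !inE => /andP[/negPf km ks'].
    by move/fsubsetP/(_ _ ks'): s'u; rewrite !inE km.
  have sn : (#|` s|%fset < n)%N by move: s'n; rewrite s'E cardfsU1 ms.
  clearbody s; have [|QE ZZ] := H s _ sn ms; first by rewrite fpowersetE.
  have [QE' ZZ'] := Gu s su (ltnW sn).
  split; first by rewrite s'E; split=> [/QE /QE'|/QE' /QE].
  move=> N; have [Nm|/late//] := leqP N m; rewrite belowu// s'E.
  have -> : below N (m |` s)%fset = below N s.
    apply/fsetP => k; rewrite !in_below !inE.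
    by case: eqP => //= ->; rewrite ltnNge Nm andbF.
  have bu : below N u \in enum_fset (fpowerset u).
    by rewrite fpowersetE; apply/fsubsetP => k; rewrite in_below => /andP[].
  by split=> [/(ZZ _ bu) /ZZ'|/ZZ' /(ZZ _ bu)].
have [B [BA infB GB]] := diagonal_set rf rA G0 Gstep.
exists B; split=> //.
have Bs s : (forall k, k \in s -> B k) -> #|` s|%fset = n ->
    (y s = y0 <-> forced Q fset0) /\ forall N, (forall k, k \in s -> (k < N)%N) ->
    forall N', (N' <= N)%N ->
      betaN_filter (y s) (Z (segment B N')) <-> tail_lim (below N' s) = y0.
  move=> sB sn.
  have sub N : (forall k, k \in s -> (k < N)%N) -> (s `<=` segment B N)%fset.
    move=> sN; apply/fsubsetP => k ks; rewrite in_segment sN//=; apply/asboolP; exact: sB.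
  split.
    have [N /sub sN] := fset_bounded s.
    have [+ _] := GB _ _ sN (eq_leq sn).
    by rewrite (forced_full Q sn).
  move=> N /sub sN N' N'N; have [_ /(_ N')] := GB _ _ sN (eq_leq sn).
  rewrite tail_lim_full//; suff -> : below N' (segment B N) = segment B N' by [].
  apply/fsetP => k; rewrite in_below !in_segment andbAC; congr (_ && _).
  by apply: andb_idl => kN'; exact: leq_trans kN' N'N.
have [Q0|nQ0] := pselect (forced Q fset0).
  by left; exists y0 => s sB sn; apply/(Bs s sB sn).1.
right; pose W m N := ~ Z (segment B N.+1) m /\ forall N', (N' < N)%N -> Z (segment B N'.+1) m.
have phiP m : exists N0, forall N, W m N -> N0 = N.
  have [[N0 [W1 W2]]|nW] := pselect (exists N, W m N); last first.
    by exists 0 => N WN; exfalso; apply: nW; exists N.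
  exists N0 => N [V1 V2]; apply/eqP; rewrite eqn_leq.
  apply/andP; split; rewrite leqNgt; apply/negP => H.
    exact: V1 (W2 _ H).
  exact: W1 (V2 _ H).
have [phi phiE] := choice phiP.
exists phi => s sB sn; have [sQ sZ] := Bs s sB sn.
have [N sN] := fset_bounded s.
have exN : exists N, `[< tail_lim (below N.+1 s) <> y0 >].
  exists N; apply/asboolP; suff -> : below N.+1 s = s.
    by rewrite tail_lim_full// => /sQ.
  apply/fsetP => k; rewrite in_below; apply: andb_idr => /sN kN; exact: ltnW.
have : exists b, tail_lim (below b.+1 s) <> y0 /\
    forall N', (N' < b)%N -> tail_lim (below N'.+1 s) = y0.
  exists (ex_minn exN); case: ex_minnP => b /asboolP bP bmin; split=> // N' N'b.
  by apply: contrapT => /asboolP /bmin; rewrite leqNgt N'b.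
move=> [b [bP bmin]]; have bs : b \in s.
  apply: contrapT => /negP nbs; apply: bP.
  have -> : below b.+1 s = below b s.
    apply/fsetP => k; rewrite !in_below ltnS leq_eqVlt; case: eqP => //= ->.
    by rewrite (negbTE nbs).
  case: (b) bmin => [_|b' /(_ b')]; last exact.
  suff -> : below 0 s = fset0 by [].
  by apply/fsetP => k; rewrite in_below andbF.
exists b => //.
have yW1 : betaN_filter (y s) (~` Z (segment B b.+1)).
  by apply: (ultra_setC (betaN_ultra _)) => /(sZ N sN b.+1 (sN _ bs)).
have yW2 : betaN_filter (y s) [set m | forall N', N' \in iota 0 b -> Z (segment B N'.+1) m].
  apply: filter_seq_all => N'; rewrite mem_iota /= => N'b.
  apply/(sZ N sN); last exact: bmin.
  by apply: leq_trans (sN _ bs); exact: ltnW.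
apply: filterS (filterI yW1 yW2) => m [W1 W2] /=; apply: phiE; split=> // N' N'b.
by apply: W2; rewrite mem_iota.
Qed.

End fusion.

(** * Many ultrafilters, and codings by sets of naturals *)

Definition prefix_of (x : set nat) (n : nat) : seq bool := mkseq (fun i => `[< x i >]) n.

Lemma prefix_of_inj (x z : set nat) :
  \forall n \near \oo, prefix_of x n = prefix_of z n -> x = z.
Proof.
have [->|xz] := pselect (x = z); first exact: nearW.
have [i xzi] : exists i, `[< x i >] <> `[< z i >].
  apply: contrapT => nxz; apply: xz; apply/funext => i; apply/propext.
  apply: asbool_eq_equiv; apply: contrapT => ne; apply: nxz; by exists i.
exists i.+1 => // n /= iN E; exfalso; apply: xzi.
have /(congr1 (fun s => nth false s i)) := E.
by rewrite !nth_mkseq.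
Qed.

Lemma infinite_inj (A : set nat) : infinite_set A ->
  exists2 e : nat -> nat, injective e & forall n, A (e n).
Proof.
move=> /infiniteP/pcard_leP[f]; exists f; last by move=> n; exact: funS.
by move=> x y; apply: 'inj_f; rewrite inE.
Qed.

(** The sets of the pairs [(n, W)] such that [W] contains the initial word of
    length [n] of [x], for [x : set nat], are independent: finitely many [x]
    have distinct initial words of some length, and [W] may be any set of them.
    So an ultrafilter can contain exactly those given by the members of [Y]. *)
Lemma independent_filter (Y : set (set nat)) :
  exists U : set_system (nat * seq (seq bool)),
  [/\ UltraFilter U, forall N, U [set s | (N <= s.1)%N] &
    forall x, U [set s | prefix_of x s.1 \in s.2] <-> Y x].
Proof.
pose base (NL : nat * seq (set nat)) : set (nat * seq (seq bool)) := [set s | (NL.1 <= s.1)%N /\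
  forall x, x \in NL.2 -> (prefix_of x s.1 \in s.2) = `[< Y x >] ].
have baseP : ProperFilter (filter_from setT base).
  apply: filter_from_proper; last first.
    move=> [N L] _.
    have E : \forall n \near \oo, forall x, x \in L -> forall z, z \in L ->
        prefix_of x n = prefix_of z n -> x = z.
      apply: filter_seq_all => x _; apply: filter_seq_all => z _.
      exact: prefix_of_inj.
    have [n [/= Nn En]] := filter_ex (filterI (nbhs_infty_ge N) E).
    exists (n, [seq prefix_of x n | x <- L & `[< Y x >]]); split=> //= x xL.
    apply/mapP/idP => [[z]|Yx]; last by exists x; rewrite // mem_filter Yx.
    by rewrite mem_filter => /andP[Yz zL] /(En x xL z zL) ->.
  apply: filter_from_filter; first by exists (0, [::]).
  move=> [N L] [N' L'] _ _; exists (maxn N N', L ++ L') => // s [/= sN sL].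
  move: sN; rewrite geq_max => /andP[sN sN'].
  by split; split=> // x xL; apply: sL; rewrite mem_cat xL ?orbT.
have [U [UU baseU]] := ultraFilterLemma baseP.
have UB NL : U (base NL) by apply: baseU; exists NL.
exists U; split=> // [N|x].
  by apply: filterS (UB (N, [::])) => s [].
have Ux := UB (0, [:: x]); split=> [Us|Yx].
  have [s [[_ /(_ x (mem_head _ _))]]] := filter_ex (filterI Ux Us).
  by move=> /= -> /asboolP.
apply: filterS Ux => s [_ /(_ x (mem_head _ _))] /= ->; exact/asboolP.
Qed.

(** Pospisil's theorem, inside an infinite set. *)
Lemma many_ultrafilters (A : set nat) : infinite_set A ->
  exists2 Psi : set (set nat) -> betaN, injective Psi &
    forall Y, nonprincipal (Psi Y) /\ betaN_filter (Psi Y) A.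
Proof.
move=> /infinite_inj[e0 e0inj e0A].
pose e (s : nat * seq (seq bool)) := e0 (choice.pickle s).
have einj : injective e by move=> s s' /e0inj /(pcan_inj choice.pickleK).
have [U UP] := choice independent_filter.
have UU Y : UltraFilter (U Y) by have [] := UP Y.
exists (fun Y => BetaN (fmap_ultra e (UU Y))) => [Y Y' [YY']|Y].
  apply/seteqP; suff H Z Z' : e @ U Z = e @ U Z' -> Z `<=` Z'.
    by split; apply: H.
  move=> ZZ' x Zx; have [_ _ /(_ x)[_ /(_ Zx) Ux]] := UP Z.
  have [_ _ /(_ x)[+ _]] := UP Z'; apply.
  have : (e @ U Z) (e @` [set s | prefix_of x s.1 \in s.2]).
    suff : U Z (e @^-1` (e @` [set s | prefix_of x s.1 \in s.2])) by [].
    by apply: filterS Ux => s sx; exists s.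
  rewrite ZZ' => UE.
  have {}UE : U Z' (e @^-1` (e @` [set s | prefix_of x s.1 \in s.2])) by [].
  by apply: filterS UE => s [s' + /einj <-].
split; last first.
  suff : U Y (e @^-1` A) by [].
  by apply: filterE => s; exact: e0A.
apply: contrapT => /principal_singleton[k /= Uk].
have [s /= sk] := filter_ex Uk.
have [_ UN _] := UP Y.
have [s' [/= /esym]] := filter_ex (filterI Uk (UN s.1.+1)).
by rewrite -sk => /einj <-; rewrite ltnn.
Qed.

Definition codable (T : Type) := exists e : T -> set nat, injective e.

Lemma codable_inj T U (e : T -> U) : injective e -> codable U -> codable T.
Proof. by move=> einj [g ginj]; exists (g \o e); exact: inj_comp. Qed.

Lemma codable_set (T : countType) : codable (set T).
Proof.
exists (fun A : set T => [set n | exists2 x, A x & choice.pickle x = n]) => A B AB.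
apply/seteqP; suff H (A' B' : set T) : [set n | exists2 x, A' x & choice.pickle x = n] =
    [set n | exists2 x, B' x & choice.pickle x = n] -> A' `<=` B' by split; apply: H.
move=> E x Ax; have : [set n | exists2 x, A' x & choice.pickle x = n] (choice.pickle x) by exists x.
by rewrite E => -[z Bz /(pcan_inj choice.pickleK) <-].
Qed.

Lemma codable_count (T : countType) : codable T.
Proof.
apply: (@codable_inj _ (set T) (fun x => [set x])) (codable_set _) => x z E.
by have : [set z] x by rewrite -E.
Qed.

Lemma codable_natfun : codable (nat -> nat).
Proof.
apply: (@codable_inj _ (set (nat * nat)%type) (fun f => [set p | p.2 = f p.1])) (codable_set _).
move=> f g E; apply/funext => n.
by have : [set p | p.2 = g p.1] (n, f n) by rewrite -E.
Qed.

Lemma codable_prod T U : codable T -> codable U -> codable (T * U).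
Proof.
move=> [e einj] [g ginj].
apply: (@codable_inj _ (set (nat + nat)%type)
  (fun p => [set s | match s with inl i => e p.1 i | inr i => g p.2 i end])) (codable_set _).
move=> [t u] [t' u'] E; congr pair.
  apply: einj; apply/funext => i; exact: (congr1 (fun S => S (inl i)) E).
apply: ginj; apply/funext => i; exact: (congr1 (fun S => S (inr i)) E).
Qed.

Lemma inj_families T : codable T ->
  exists E : (T -> set (set nat)) -> set (set nat), injective E.
Proof.
move=> Tc; have [e einj] : codable (T * set nat).
  by apply: codable_prod => //; exists id.
exists (fun h => [set z | exists t x, h t x /\ z = e (t, x)]) => h h' hh'.
apply/funext => t; apply/seteqP.
suff H g g' : [set z | exists t x, g t x /\ z = e (t, x)] =
    [set z | exists t x, g' t x /\ z = e (t, x)] -> g t `<=` g' t by split; apply: H.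
move=> E x gx.
have : [set z | exists t x, g t x /\ z = e (t, x)] (e (t, x)) by exists t, x.
by rewrite E => -[t' [x' [g'x /einj[-> ->]]]].
Qed.

(** * Well-orders with short initial segments *)

Lemma well_founded_order (T : Type) : exists R : T -> T -> Prop,
  well_founded R /\ forall a b, [\/ R a b, a = b | R b a].
Proof.
have [R Rwo] := wochoice.well_ordering_principle {classic T}.
have Rc : wochoice.wo_chain R predT by move=> A _; exact: Rwo.
have Rtot a b : R a b || R b a by exact: (wochoice.wo_chainW Rc).
have Ranti a b : R a b -> R b a -> a = b.
  by move=> ab ba; apply: (wochoice.wo_chain_antisymmetric Rc) => //; rewrite ab ba.
exists (fun a b => R a b /\ a <> b); split=> [a|a b].
  apply: contrapT => na.
  have [|z [[/asboolP zA zmin] _]] := Rwo [pred x | `[< ~ Acc (fun a b => R a b /\ a <> b) x >]].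
    by exists a; apply/asboolP.
  apply: zA; constructor => y [yz ynz]; apply: contrapT => nAy.
  by apply: ynz; apply: Ranti => //; apply: zmin; apply/asboolP.
have [->|ab] := pselect (a = b); first by constructor 2.
by have /orP[H|H] := Rtot a b; [constructor 1|constructor 3]; split=> // /esym.
Qed.

(** An initial segment that is mapped onto [U], taken as short as possible,
    contains a copy of [T]; the order pulled back to [T] has only shorter
    initial segments. *)
Lemma short_well_order (T U : Type) (e : T -> U) : injective e ->
  exists R : T -> T -> Prop,
  [/\ well_founded R, (forall a b, [\/ R a b, a = b | R b a]) &
    forall t, ~ exists F : T -> U, forall u, exists2 t', R t' t & F t' = u].
Proof.
move=> einj; have [W [Wwf Wtot]] := well_founded_order T.
pose long t := exists F : T -> U, forall u, exists2 t', W t' t & F t' = u.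
have [[t1 lt1]|nolong] := pselect (exists t, long t); last first.
  by exists W; split=> // t lt; apply: nolong; exists t.
have [t0 lt0 t0min] : exists2 t0, long t0 & forall t, W t t0 -> ~ long t.
  move: lt1; elim/(well_founded_ind Wwf): t1 => t IH lt.
  have [[t' t't lt']|nt] := pselect (exists2 t', W t' t & long t'); first exact: IH lt'.
  by exists t => // t' t't lt'; apply: nt; exists t'.
have [F FP] := lt0.
have wP u : exists t', W t' t0 /\ F t' = u by have [t' ? ?] := FP u; exists t'.
have [w wE] := choice wP.
(* [t0] is the least element with a long segment, so the copy [psi] of [T]
   below [t0] sees only short segments. *)
pose psi := w \o e.
have psi_inj : injective psi.
  by apply: inj_comp einj => u v uv; rewrite -(wE u).2 uv (wE v).2.
exists (fun a b => W (psi a) (psi b)); split=> [|a b|t [F' F'P]].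
- have H z : forall a, psi a = z -> Acc (fun a b => W (psi a) (psi b)) a.
    elim/(well_founded_ind Wwf): z => z IH a az; constructor => b Wba.
    by apply: (IH (psi b)) => //; rewrite -az.
  by move=> a; exact: H erefl.
- have [H|/psi_inj H|H] := Wtot (psi a) (psi b).
  + by constructor 1.
  + by constructor 2.
  + by constructor 3.
apply: (t0min (psi t) (wE _).1).
have GP z : exists u, forall t', z = psi t' -> u = F' t'.
  have [[t' zt']|nz] := pselect (exists t', z = psi t').
    by exists (F' t') => t'' ; rewrite zt' => /psi_inj ->.
  by exists (e z) => t' zt'; exfalso; apply: nz; exists t'.
have [G GE] := choice GP.
by exists G => u; have [t' t't <-] := F'P u; exists (psi t') => //; exact: GE.
Qed.

(** * Distributivity *)

(** The property of [I] that being smaller than the distributivity number is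
    used for; unlike a cardinal inequality, it passes to products with countable
    types without any cardinal arithmetic. *)
Definition distributive (I : Type) := forall D : I -> set (set nat),
  (forall i, dense_downclosed (D i)) -> exists2 A, infinite_set A & forall i, D i A.

Lemma dense_downclosed_infinite : dense_downclosed [set A | infinite_set A].
Proof.
split=> // A infA; exists A => //.
by rewrite /almost_subset setDv; exact: finite_set0.
Qed.

Lemma almost_subset_trans A B C : almost_subset A B -> almost_subset B C -> almost_subset A C.
Proof.
move=> AB BC; apply: (@sub_finite_set _ _ ((A `\` B) `|` (B `\` C))).
  by move=> n [An nC]; have [Bn|nB] := pselect (B n); [right|left].
by rewrite finite_setU.
Qed.

Lemma subset_almost A B : A `<=` B -> almost_subset A B.
Proof.
move=> AB; rewrite /almost_subset; suff -> : A `\` B = set0 by exact: finite_set0.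
by apply/seteqP; split=> // n [/AB].
Qed.

Lemma dense_downclosed_bigcap (D : nat -> set (set nat)) :
  (forall k, dense_downclosed (D k)) ->
  dense_downclosed [set A | infinite_set A /\ forall k, D k A].
Proof.
move=> Dd; split=> [A []//|A infA|A B [infB DB] infA AB]; last first.
  by split=> // k; have [_ _ Dk] := Dd k; exact: Dk AB.
have stepP (kS : nat * set nat) : exists S', infinite_set kS.2 ->
    [/\ infinite_set S', S' `<=` kS.2 & D kS.1 S'].
  case: kS => k S /=; have [infS|?] := pselect (infinite_set S); last by exists set0.
  have [Dinf Ddense Ddown] := Dd k; have [B DB BS] := Ddense S infS.
  exists (B `&` S) => _; have infBS : infinite_set (B `&` S).
    move=> fBS; apply: (Dinf _ DB); rewrite -(setUIDK B S).
    by rewrite finite_setU.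
  split=> //; apply: (Ddown _ B) => //; exact: subset_almost.
have [g gP] := choice stepP.
pose S k := iteri k (fun j X => g (j, X)) A.
have Sinf k : infinite_set (S k) by elim: k => //= k /(gP (k, _))[].
have SS k : S k.+1 `<=` S k /\ D k (S k.+1) by have [] := gP (k, _) (Sinf k).
have Smono j k : (j <= k)%N -> S k `<=` S j.
  elim: k => [|k IH]; first by rewrite leqn0 => /eqP ->.
  rewrite leq_eqVlt => /orP[/eqP <-//|/IH H]; apply: subset_trans H; exact: (SS k).1.
have bP k : exists m, S k m /\ (k <= m)%N.
  apply: contrapT => nm; apply: (Sinf k); apply: (@sub_finite_set _ _ `I_k); last exact: finite_II.
  by move=> m Sm /=; rewrite ltnNge; apply/negP => km; apply: nm; exists m.
have [b bE] := choice bP.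
have infb : infinite_set (range b).
  move=> /finite_fsetP[F FE]; have [N FN] := fset_bounded F.
  have : [set` F] (b N) by rewrite -FE; exists N.
  by move=> /= /FN; rewrite ltnNge (bE N).2.
have bS k : almost_subset (range b) (S k).
  apply: (@sub_finite_set _ _ (b @` `I_k)); last exact/finite_image/finite_II.
  move=> _ [[j _ <-] nSj]; exists j => //=; rewrite ltnNge; apply/negP => kj.
  by apply: nSj; apply: (Smono _ _ kj); exact: (bE j).1.
exists (range b); last exact: (bS 0).
split=> // k; have [_ _ Dk] := Dd k; exact: Dk (SS k).2 infb (bS k.+1).
Qed.

(** Intersect the countably many dense sets attached to each index first. *)
Lemma distributive_prod I (T : countType) : distributive I -> distributive (I * T).
Proof.
move=> Id D Dd.
pose Dk i k := if choice.unpickle k is Some t then D (i, t) else [set A | infinite_set A].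
have [|A infA DA] := Id (fun i => [set A | infinite_set A /\ forall k, Dk i k A]).
  move=> i; apply: dense_downclosed_bigcap => k; rewrite /Dk.
  by case: choice.unpickle => [t|]; [exact: Dd|exact: dense_downclosed_infinite].
exists A => // -[i t]; have [_ /(_ (choice.pickle t))] := DA i.
by rewrite /Dk choice.pickleK.
Qed.

Lemma distributive_nat : distributive nat.
Proof.
have unitd : distributive unit.
  move=> D Dd; have [Dinf /(_ setT infinite_nat)[A DA _] _] := Dd tt.
  by exists A => [|[]//]; exact: Dinf.
move=> D Dd; have [|A infA DA] := distributive_prod unitd (T := nat) (D := fun p => D p.2).
  by move=> [? n]; exact: Dd.
by exists A => // n; exact: (DA (tt, n)).
Qed.

(** These dense sets have no common element when [A] varies, since a common
    element would avoid itself; they bound the distributivity number by the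
    continuum. *)
Lemma dense_downclosed_avoid A : infinite_set A ->
  dense_downclosed [set B | infinite_set B /\ ~ almost_subset A B].
Proof.
move=> infA; split=> [B []//|B infB|B' B [infB nAB] infB' B'B]; last first.
  by split=> // AB'; apply: nAB; exact: almost_subset_trans B'B.
have [AB|nAB] := pselect (almost_subset A B); last by exists B => //; exact: subset_almost.
have infAB : infinite_set (A `&` B).
  by move=> fAB; apply: infA; rewrite -(setUIDK A B) finite_setU.
have [E [EAB infE infABE]] := infinite_set_split infAB.
exists E; last by apply: subset_almost => x /EAB[].
by split=> // AE; apply: infABE; apply: sub_finite_set AE => x [[Ax _] nEx].
Qed.

Lemma distributive_not_continuum I : distributive I ->
  ~ exists e : set nat -> I, injective e.
Proof.
move=> Id [e einj].
have [|B infB BD] := Id (fun i => [set B | infinite_set B /\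
    forall A, infinite_set A -> e A = i -> ~ almost_subset A B]).
  move=> i; have [[A infA <-]|nA] := pselect (exists2 A, infinite_set A & e A = i).
    suff -> : [set B | infinite_set B /\
        forall A', infinite_set A' -> e A' = e A -> ~ almost_subset A' B] =
      [set B | infinite_set B /\ ~ almost_subset A B] by exact: dense_downclosed_avoid.
    apply/seteqP; split=> B [infB H]; split=> //; first exact: H.
    by move=> A' _ /einj ->.
  suff -> : [set B | infinite_set B /\
      forall A, infinite_set A -> e A = i -> ~ almost_subset A B] =
    [set B | infinite_set B] by exact: dense_downclosed_infinite.
  apply/seteqP; split=> B; first by case.
  by move=> infB; split=> // A infA eA; exfalso; apply: nA; exists A.
have [_ /(_ B infB erefl)] := BD (e B); apply; exact: subset_almost.
Qed.

Lemma card_lt_distributive I : card_lt [set: I] distributivity_number -> distributive I.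
Proof.
move=> [_ nhI] D Dd; apply: contrapT => nA; apply: nhI.
have [_ hmin] := distributivity_numberP.
have : range D #<= [set: I] by exact: card_image_le.
apply: card_le_trans; apply: hmin; split=> [_ [i _ <-]//|].
apply/seteqP; split=> // A DA; apply: nA.
have [[i _]|nI] := pselect (exists i : I, True).
  exists A => [|j]; last by apply: DA; exists j.
  by have [Dinf _ _] := Dd i; apply: Dinf; apply: DA; exists i.
by exists setT => [|i]; [exact: infinite_nat|exfalso; apply: nI; exists i].
Qed.

Lemma card_lt_codable I : card_lt [set: I] distributivity_number -> codable I.
Proof.
move=> [Ih _]; have [_ hmin] := distributivity_numberP.
pose avoid (A : set nat) : set (set nat) := [set B | infinite_set B /\ ~ almost_subset A B].
have : [set: I] #<= [set: set nat].
  apply: card_le_trans Ih _.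
  apply: (@card_le_trans _ _ _ (avoid @` [set A | infinite_set A])); last first.
    by apply: card_le_trans (card_image_le _ _) _; exact: subset_card_le.
  apply: hmin; split=> [_ [A infA <-]|]; first exact: dense_downclosed_avoid.
  apply/seteqP; split=> // B HB.
  have [infB _] : avoid setT B by apply: HB; exists setT => //; exact: infinite_nat.
  have [_ []] : avoid B B by apply: HB; exists B.
  exact: subset_almost.
move=> /pcard_leP[f]; exists f => a b ab.
by apply: (@inj _ _ setT f) => //; rewrite inE.
Qed.

(** * Blocks, selections and the omitted points *)

Definition block (m : nat) : nat :=
  if choice.unpickle m is Some s then size (s : seq bool) else 0.

Definition selection (x : set nat) (n : nat) : nat := choice.pickle (prefix_of x n).

Lemma selectionK x : cancel (selection x) block.
Proof. by move=> n; rewrite /block /selection choice.pickleK size_mkseq. Qed.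

Lemma block_selection x P : bmap block (bmap (selection x) P) = P.
Proof.
apply: betaN_le_eq => A PA.
have {}PA : betaN_filter P [set n | A (block (selection x n))] by [].
by apply: filterS PA => n /=; rewrite selectionK.
Qed.

Lemma selection_inj P : nonprincipal P -> injective (fun x => bmap (selection x) P).
Proof.
move=> Pf x x' E; apply: contrapT => xx'.
have [N _ NP] := prefix_of_inj x x'.
pose S : set nat := selection x @` [set n | (N <= n)%N].
have : betaN_filter (bmap (selection x) P) S.
  by rewrite bmapE; apply: filterS (nonprincipal_ge N Pf) => n Nn; exists n.
rewrite E bmapE => /filter_ex[n [k /= Nk kn]].
have kn' : k = n by rewrite -(selectionK x k) kn selectionK.
by move: kn; rewrite -kn' => /(pcan_inj choice.pickleK); exact: (contra_not (NP k Nk)).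
Qed.

(** A selection is injective on the blocks, so the ultrafilters containing its
    range are determined by their image under [block]: the omitted points are
    isolated in their fibres. *)
Lemma eq_selection x q : betaN_filter q (range (selection x)) ->
  q = bmap (selection x) (bmap block q).
Proof.
move=> qx; apply: betaN_le_eq => A qA.
suff : betaN_filter q [set m | A (selection x (block m))] by [].
by apply: filterS (filterI qx qA) => _ [[n _ <-]] /=; rewrite selectionK.
Qed.

(** The second alternative says that [q] lies below the block ultrafilter of
    the limit in the Rudin-Keisler order. *)
Definition stable_or_above (q : betaN) (k : nat) (f : {fset nat} -> betaN) : Prop :=
  (exists P, power_filter (betaN_filter q) k [set s | bmap block (f s) = P]) \/
  (exists phi, q = bmap phi (bmap block (clim q k f))).

(** Downward closure is immediate as only the free ultrafilters containing [A]
    matter; density is [constant_or_readable], since an element of [s] lies in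
    every member of [q] containing [s], whichever element it is. *)
Lemma dense_stable_or_above k f :
  dense_downclosed [set A | infinite_set A /\ forall q, nonprincipal q ->
    betaN_filter q A -> stable_or_above q k f].
Proof.
split=> [A []//|A infA|A B [infB HB] infA AB]; last first.
  split=> // q qf qA; apply: HB => //; exact: nonprincipal_almost_subset AB.
have [Psi _ PsiP] := many_ultrafilters infA; have [rf rA] := PsiP set0.
have [B [BA infB HB]] := constant_or_readable rf k (fun s => bmap block (f s)) rA.
exists B; last exact: subset_almost.
split=> // q qf qB; case: HB => [[P HP]|[phi Hphi]].
  left; exists P; have := power_filter_ultra k (betaN_ultra q) => ?.
  by apply: filterS (power_filter_subsets k qf qB) => s [sB sk]; exact: HP.
right; exists phi; apply: betaN_le_eq => Z qZ; rewrite !bmapE /=.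
have qBZ : betaN_filter q (B `&` Z) by exact: filterI.
have ? := power_filter_ultra k (betaN_ultra q).
have H := power_filter_subsets k qf qBZ.
suff : power_filter (betaN_filter q) k
  [set s | betaN_filter (f s) (block @^-1` (phi @^-1` Z))] by [].
apply: filterS H => s [sBZ sk] /=.
have [b bs fb] : exists2 b, b \in s & betaN_filter (bmap block (f s)) [set m | phi m = b].
  by apply: Hphi => // j /sBZ[].
by apply: filterS fb => m /= ->; have [] := sBZ _ bs.
Qed.

(** The families of functions are indexed by all sets of naturals, so that the
    tasks form a single type; smaller index types are coded into it. *)
Definition task : Type := (nat * ({fset nat} -> set nat -> betaN))%type.

Definition limit_index : Type := (set nat * (seq nat * nat))%type.

Definition task_limit (q : betaN) (t : task) (j : limit_index) : betaN :=
  clim q j.2.2 (foldl (@slice _) (fun s => t.2 s j.1) j.2.1).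

(** What the construction asks of the ultrafilter chosen for a task.  The second
    clause leaves room for a selection avoiding all limit points at once. *)
Definition controlled (q : betaN) (t : task) : Prop :=
  (forall j : limit_index,
     stable_or_above q j.2.2 (foldl (@slice _) (fun s => t.2 s j.1) j.2.1)) /\
  forall P, nonprincipal P -> exists x, forall j, bmap (selection x) P <> task_limit q t j.

Definition tame (t : task) : Prop := exists2 A, infinite_set A &
  forall q, nonprincipal q -> betaN_filter q A -> controlled q t.

(** If every selection met a limit point, distinct selections having distinct
    images of [P], the continuum would embed into a distributive index type. *)
Lemma distributive_tame I (f : {fset nat} -> I -> betaN) (e : set nat -> I) n :
  distributive I -> tame (n, fun s c => f s (e c)).
Proof.
move=> Id; have Id' := @distributive_prod _ (seq nat * nat)%type Id.
pose F (p : I * (seq nat * nat)) := foldl (@slice _) (fun s => f s p.1) p.2.1.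
have [|A infA DA] := Id' (fun p => [set A | infinite_set A /\ forall q, nonprincipal q ->
    betaN_filter q A -> stable_or_above q p.2.2 (F p)]).
  by move=> p; exact: dense_stable_or_above.
exists A => // q qf qA; split=> [[c msk]|P Pf].
  by have [_] := DA (e c, msk); apply.
apply: contrapT => nx.
have xP x : exists p : I * (seq nat * nat), bmap (selection x) P = clim q p.2.2 (F p).
  apply: contrapT => np; apply: nx; exists x => -[c msk] E; apply: np.
  by exists (e c, msk).
have [h hE] := choice xP.
apply: (distributive_not_continuum Id'); exists h => x x' hx.
by apply: (selection_inj Pf); rewrite /= !hE hx.
Qed.

(** Ultrafilters containing [A] are obtained injectively from all functions from
    [J] to the sets of sets of naturals.  For each [j] the [j]-th values of the
    functions that code the [bad t j] do not exhaust the possible values, as [S]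
    is too small; a function taking at each [j] a missed value codes an
    ultrafilter that differs from all of them. *)
Lemma koenig (T J : Type) (S : T -> Prop) (A : set nat) (bad : T -> J -> betaN) :
  codable J -> infinite_set A ->
  ~ (exists F : T -> set (set nat), forall u, exists2 t, S t & F t = u) ->
  exists q, [/\ nonprincipal q, betaN_filter q A & forall t j, S t -> q <> bad t j].
Proof.
move=> Jc infA Ssmall; have [Psi Psi_inj PsiP] := many_ultrafilters infA.
have [E E_inj] := inj_families Jc.
have decP b : exists h : J -> set (set nat), forall h', Psi (E h') = b -> h = h'.
  have [[h <-]|nh] := pselect (exists h, Psi (E h) = b).
    by exists h => h' /Psi_inj /E_inj.
  by exists (fun=> set0) => h' hb; exfalso; apply: nh; exists h'.
have [dec decE] := choice decP.
have missP j : exists u, forall t, S t -> dec (bad t j) j <> u.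
  apply: contrapT => nu; apply: Ssmall; exists (fun t => dec (bad t j) j) => u.
  apply: contrapT => nt; apply: nu; exists u => t St tu; apply: nt.
  by exists t.
have [h hP] := choice missP.
exists (Psi (E h)); have [? ?] := PsiP (E h); split=> // t j St bE.
by apply: (hP j t St); rewrite (decE _ _ bE).
Qed.

(** Well-founded recursion whose step is only known to exist. *)
Lemma wf_choice (T V : Type) (R : T -> T -> Prop) (spec : T -> (T -> V) -> V -> Prop) (v0 : V) :
  well_founded R ->
  (forall t G G' v, (forall t', R t' t -> G t' = G' t') -> spec t G v -> spec t G' v) ->
  (forall t G, exists v, spec t G v) -> exists G, forall t, spec t G (G t).
Proof.
move=> Rwf spec_local spec_ex.
have specP (p : T * (T -> V)) : exists v, spec p.1 p.2 v by exact: spec_ex.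
have [next nextP] := choice specP.
pose extend t (rec : forall t', R t' t -> V) t' :=
  if pselect (R t' t) is left H then rec t' H else v0.
pose G := Fix Rwf (fun=> V) (fun t rec => next (t, extend t rec)).
have GE t : G t = next (t, extend t (fun t' _ => G t')).
  rewrite /G Fix_eq // => {}t f g fg; congr (next (_, _)).
  by apply/funext => t'; rewrite /extend; case: pselect.
exists G => t; rewrite [G t]GE.
apply: (spec_local t (extend t (fun t' _ => G t'))); last exact: (nextP (t, _)).
by move=> t' Rt't; rewrite /extend; case: pselect.
Qed.

Lemma codable_limit_index : codable limit_index.
Proof.
by apply: codable_prod; [exists id|exact: codable_count].
Qed.

Lemma task_inj : exists e : task -> set (set nat), injective e.
Proof.
have [E E_inj] : exists E : (nat * {fset nat} * set nat -> set (set nat)) -> set (set nat),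
    injective E.
  by apply: inj_families; apply: codable_prod; [exact: codable_count|exists id].
exists (fun t => E (fun i => [set B | i.1.1 = t.1 /\ betaN_filter (t.2 i.1.2 i.2) B])).
move=> [n f] [n' f'] /E_inj /= H.
have HB m s c B : m = n /\ betaN_filter (f s c) B <-> m = n' /\ betaN_filter (f' s c) B.
  by have /(congr1 (fun S => S B)) /= -> := congr1 (fun S => S (m, s, c)) H.
have nn' : n = n'.
  by have [/(_ (conj erefl filterT))[]] := HB n fset0 set0 setT.
congr pair => //; apply/funext => s; apply/funext => c; apply: betaN_le_eq => B fB.
by have [/(_ (conj erefl fB))[]] := HB n s c B.
Qed.

(** * The choice of the omitted points *)

Definition selective_set (xi : betaN -> set nat) : set betaN :=
  [set q | nonprincipal (bmap block q) ->
     q <> bmap (selection (xi (bmap block q))) (bmap block q)].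

Lemma betaN_of_nat_principal n : ~ nonprincipal (betaN_of_nat n).
Proof.
move=> nf; have H := nonprincipal_ge n.+1 nf; suff : (n < n)%N by rewrite ltnn.
exact: H.
Qed.

Lemma foldl_slice T (X : set T) ms (f : {fset nat} -> T) :
  (forall s, X (f s)) -> forall s, X (foldl (@slice _) f ms s).
Proof. by elim: ms f => [//|m ms IH] f fX s /=; apply: IH => s'; exact: fX. Qed.

(** The value [xi P] is settled at the first task whose limit points lie over
    [P].  If a limit point [p] of a tame task were the omitted point over
    [P = block p], two cases arise.  Either the functions are almost
    everywhere in the fibre of [P], and then some value already is the isolated
    point [p], outside the set; or the ultrafilter of the task lies below [P],
    so that no earlier task met [P], and [xi P] was chosen against [p]. *)
Lemma selective_assignment : exists xi : betaN -> set nat, forall t, tame t ->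
  exists2 q, nonprincipal q & forall c, (forall s, selective_set xi (t.2 s c)) ->
    forall ms k, selective_set xi (task_limit q t (c, (ms, k))).
Proof.
have [e e_inj] := task_inj.
have [R [Rwf Rtot Rshort]] := short_well_order e_inj.
pose spec (t : task) (G : task -> betaN) (q : betaN) := tame t ->
  [/\ nonprincipal q, controlled q t & forall t' (jphi : limit_index * (nat -> nat)), R t' t ->
    q <> bmap jphi.2 (bmap block (task_limit (G t') t' jphi.1))].
have [|t G|q qspec] := @wf_choice task betaN R spec (betaN_of_nat 0) Rwf.
- move=> t G G' q GG' H /H[qf qc qR]; split=> // t' jphi Rt't; rewrite -GG'//.
  exact: qR.
- have [[A infA HA]|nt] := pselect (tame t); last by exists (betaN_of_nat 0).
  have [|q [qf qA qR]] := @koenig task (limit_index * (nat -> nat))%type (R^~ t) A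
    (fun t' jphi => bmap jphi.2 (bmap block (task_limit (G t') t' jphi.1))) _ infA (Rshort t).
    by apply: codable_prod; [exact: codable_limit_index|exact: codable_natfun].
  by exists q => _; split=> //; exact: HA.
pose met t P := exists j, P = bmap block (task_limit (q t) t j).
pose owner t P := met t P /\ forall t', R t' t -> ~ met t' P.
have xiP P : exists x, forall t, tame t -> nonprincipal P -> owner t P ->
    forall j, bmap (selection x) P <> task_limit (q t) t j.
  have [[t [tt Pf [metP firstP]]]|nt] :=
    pselect (exists t, [/\ tame t, nonprincipal P & owner t P]); last first.
    by exists set0 => t tt Pf tP; exfalso; apply: nt; exists t.
  have [_ [_ /(_ P Pf)[x xP]] _] := qspec t tt.
  exists x => t' tt' _ [metP' firstP'].
  have [Rt't|->//|Rtt'] := Rtot t' t; first by have := firstP _ Rt't.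
  by have := firstP' _ Rtt'.
have [xi xiE] := choice xiP.
exists xi => t tt; have [qf [qsa _] qR] := qspec t tt.
exists (q t) => // c fX ms k; set p := task_limit _ _ _ => Pf pE.
set P := bmap block p in Pf pE.
have := qsa (c, (ms, k)); rewrite /stable_or_above /= -/(task_limit (q t) t (c, (ms, k))).
set f := foldl _ _ _.
have pfE : p = clim (q t) k f by [].
case=> [[P' HP']|[phi qphi]].
  have ? := power_filter_ultra k (betaN_ultra (q t)).
  have PP' : P = P'.
    apply: betaN_le_eq => A PA; have : power_filter (betaN_filter (q t)) k
      [set s | betaN_filter (bmap block (f s)) A] by [].
    by move=> /(filterI HP')/filter_ex[s [/= <-]].
  have : betaN_filter p (range (selection (xi P))).
    by rewrite pE bmapE; apply: filterE => n; exists n.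
  move=> px; have {}px : power_filter (betaN_filter (q t)) k
      [set s | betaN_filter (f s) (range (selection (xi P)))] by [].
  have [s [/= fP' fx]] := filter_ex (filterI HP' px).
  have fsX : selective_set xi (f s).
    exact: (foldl_slice (X := selective_set xi)).
  by apply: fsX; rewrite fP' -PP' //; have := eq_selection fx; rewrite fP' -PP'.
(* A map from [P] onto [q t] excludes [P] from the ultrafilters met earlier. *)
have tP : owner t P.
  split; first by exists (c, (ms, k)).
  move=> t' Rt't [j Pj]; apply: (qR t' (j, phi) Rt't) => /=.
  by rewrite -Pj.
by apply: (xiE P t tt Pf tP (c, (ms, k))); rewrite -pE.
Qed.

(** * The hyperspace *)

Lemma vietoris_subbase_nbhs (X : topologicalType) (L : hyperspace X) W :
  @vietoris_subbase X W -> W L -> nbhs L W.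
Proof.
move=> sW WL; apply: open_nbhs_nbhs; split=> //.
exists [set W]; last exact: bigcup_set1.
by move=> _ ->; exact: (@finI_from1 _ _ _ id).
Qed.

Lemma nbhs_upper (X : topologicalType) (L : hyperspace X) (U : set X) :
  open U -> (L : set X) `<=` U -> nbhs L (vietoris_upper U).
Proof. by move=> oU LU; apply: vietoris_subbase_nbhs => //; left; exists U. Qed.

Lemma nbhs_lower (X : topologicalType) (L : hyperspace X) (U : set X) :
  open U -> (L : set X) `&` U !=set0 -> nbhs L (vietoris_lower U).
Proof. by move=> oU LU; apply: vietoris_subbase_nbhs => //; right; exists U. Qed.

Section trace.
Variable X : set betaN.

Definition trace (A : set nat) : set (set_type X) := [set z | betaN_filter (val z) A].

Lemma open_trace A : open (trace A).
Proof.
exists (stone_open A) => //.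
exists [set A] => //; exact: bigcup_set1.
Qed.

Lemma trace_setC A : trace (~` A) = ~` trace A.
Proof.
apply/seteqP; split=> z; first exact: filter_setC_not.
by move=> /ultra_setC; apply; exact: betaN_ultra.
Qed.

Lemma closed_trace A : closed (trace A).
Proof. by rewrite -openC -trace_setC; exact: open_trace. Qed.

Definition fills_block (n : nat) (L : set (set_type X)) : Prop :=
  L `<=` trace (block @^-1` [set n]) /\
  forall t : n.-tuple bool, L `&` trace [set choice.pickle (tval t)] !=set0.

End trace.

Lemma selection_tuple x n : exists t : n.-tuple bool, selection x n = choice.pickle (tval t).
Proof.
have sz : size (prefix_of x n) == n by rewrite size_mkseq.
by exists (Tuple sz).
Qed.

Section selective_hyperspace.
Variable xi : betaN -> set nat.
Let X := selective_set xi.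
Let HX := hyperspace (set_type X).

Lemma fills_block_unique n m (L : HX) : fills_block n L -> fills_block m L -> n = m.
Proof.
have [z Lz] := hyperset_nonempty L.
move=> [/(_ z Lz) zn _] [/(_ z Lz) zm _].
by have [k [/= <- <-]] := filter_ex (filterI zn zm).
Qed.

(** Let [L] be a closed set.  Inside one block, [L] is surrounded by closed sets
    of the same block, and filling it is decided by finitely many points.  If
    two points of [L] lie over different ultrafilters, nearby sets meet two
    different blocks.  Otherwise [L] lies over a single free [P], and the
    omitted point over [P] lets nearby sets avoid the graph of a selection,
    hence at least one point of every block. *)
Lemma near_fills_block (L : HX) :
  \forall L' \near nbhs L, forall n, fills_block n (L' : HX) <-> fills_block n L.
Proof.
have [[n Ln]|nconst] := pselect (exists n, (L : set _) `<=` trace (block @^-1` [set n])).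
  have near_n : \forall L' \near nbhs L, forall m, fills_block m (L' : HX) -> m = n.
    have := nbhs_upper (open_trace _ _) Ln.
    apply: filterS => L' L'n m [L'm _]; have [z L'z] := hyperset_nonempty L'.
    by have [k [/= <- <-]] := filter_ex (filterI (L'm z L'z) (L'n z L'z)).
  have Lm m : fills_block m L -> m = n by exact: (nbhs_singleton near_n).
  have [fillL|nfillL] := pselect (fills_block n L).
    have near_t : \forall L' \near nbhs L, forall t, t \in enum {: n.-tuple bool} ->
        vietoris_lower (trace [set choice.pickle (tval t)]) (L' : HX).
      apply: filter_seq_all => t _; apply: nbhs_lower; first exact: open_trace.
      exact: fillL.2.
    apply: filterS (filterI near_n (filterI near_t (nbhs_upper (open_trace _ _) Ln))).
    move=> L' [near' [lowL' L'n]] m; split=> [/near' ->//|/Lm ->].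
    by split=> // t; apply: lowL'; rewrite mem_enum.
  have [t nt] : exists t : n.-tuple bool,
      ~ ((L : set _) `&` trace [set choice.pickle (tval t)] !=set0).
    by apply: contrapT => H; apply: nfillL; split=> // t; apply: contrapT => nt; apply: H; exists t.
  have Lt : (L : set _) `<=` trace (~` [set choice.pickle (tval t)]).
    by move=> z Lz; rewrite trace_setC => zt; apply: nt; exists z.
  apply: filterS (filterI near_n (nbhs_upper (open_trace _ _) Lt)).
  move=> L' [near' L't] m; split=> [fL'|/[dup] /Lm ->//].
  have mn := near' _ fL'; move: fL'; rewrite mn => -[_ /(_ t)[z [L'z zt]]].
  by have := L't z L'z; rewrite trace_setC.
have nfill m : ~ fills_block m L by move=> [Lm _]; apply: nconst; exists m.
suff : \forall L' \near nbhs L, forall m, ~ fills_block m (L' : HX).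
  by apply: filterS => L' nf m; split=> [/nf|/nfill].
have [[z [z' [Lz Lz' zz']]]|same] := pselect (exists z z', [/\ (L : set _) z, (L : set _) z' &
    bmap block (val z) <> bmap block (val z')]).
  have [W zW z'W] := betaN_sep zz'.
  have zl : (L : set _) `&` trace (block @^-1` W) !=set0 by exists z.
  have z'l : (L : set _) `&` trace (~` (block @^-1` W)) !=set0.
    by exists z'; split=> //; rewrite trace_setC.
  apply: filterS (filterI (nbhs_lower (open_trace _ _) zl) (nbhs_lower (open_trace _ _) z'l)).
  move=> L' [[u [L'u uW]] [v [L'v vW]]] m [L'm _].
  have [k [km Wk]] := filter_ex (filterI (L'm u L'u) uW).
  have [k' [k'm nWk']] := filter_ex (filterI (L'm v L'v) vW).
  by apply: nWk'; rewrite /= k'm -[m in W m]km.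
have [z0 Lz0] := hyperset_nonempty L.
pose P := bmap block (val z0).
have LP z : (L : set _) z -> bmap block (val z) = P.
  by move=> Lz; apply: contrapT => zP; apply: same; exists z, z0.
have Pf : nonprincipal P.
  apply: contrapT => /principal_singleton[n Pn]; apply: nconst; exists n => z Lz.
  have : betaN_filter (bmap block (val z)) [set n] by rewrite LP.
  exact.
(* The only ultrafilter over [P] containing this range is the omitted point. *)
have Lsel : (L : set _) `<=` trace (~` range (selection (xi P))).
  move=> z Lz; rewrite trace_setC => /eq_selection; rewrite LP// => zE.
  by have := set_valP z => /(_ ltac:(rewrite LP//)); rewrite LP.
have := nbhs_upper (open_trace _ _) Lsel.
apply: filterS => L' L'sel m [_ L'm].
have [t tE] := selection_tuple (xi P) m.
have [z [L'z zt]] := L'm t; have := L'sel z L'z; rewrite trace_setC; apply.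
by apply: filterS zt => _ ->; exists m.
Qed.

Lemma bmap_principal f n : bmap f (betaN_of_nat n) = betaN_of_nat (f n).
Proof. by apply: betaN_le_eq => A H _ ->; exact: H. Qed.

Lemma selective_of_nat n : X (betaN_of_nat n).
Proof. by rewrite /X /selective_set /= bmap_principal => /betaN_of_nat_principal. Qed.

Lemma fills_block_ex n : exists L : HX, fills_block n L.
Proof.
pose S : set nat := [set k | exists t : n.-tuple bool, k = choice.pickle (tval t)].
pose pt k : set_type X := exist _ (betaN_of_nat k) (mem_set (@selective_of_nat k)).
have S0 : trace (X := X) S !=set0.
  by exists (pt (choice.pickle (nseq n true))); exists [tuple of nseq n true].
exists (Hyperspace (@closed_trace X S) S0); split=> /= [z|t].
  by apply: filterS => _ [t ->] /=; rewrite /block choice.pickleK size_tuple.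
by exists (pt (choice.pickle (tval t))); split=> //; exists t.
Qed.

Lemma selective_not_pseudocompact (R : realType) : ~ pseudocompact R HX.
Proof.
have hP (L : HX) : exists r : R, (forall n, fills_block n L -> r = n%:R%R) /\
    ((forall n, ~ fills_block n L) -> r = 0%R).
  have [[n Ln]|nL] := pselect (exists n, fills_block n L).
    exists n%:R%R; split=> [m /(fills_block_unique Ln) ->//|/(_ n)//].
  by exists 0%R; split=> // n Ln; exfalso; apply: nL; exists n.
have [h hE] := choice hP.
move=> /(_ h)[|M [_ hM]].
  move=> L U hU; suff: nbhs L [set L' | U (h L')] by [].
  have := @near_fills_block L; apply: filterS => L' LL' /=.
  suff -> : h L' = h L by exact: nbhs_singleton.
  have [[n Ln]|nL] := pselect (exists n, fills_block n L).
    by rewrite ((hE L).1 n Ln) ((hE L').1 n)//; exact/LL'.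
  rewrite (hE L).2 ?(hE L').2// => n; last by move=> Ln; apply: nL; exists n.
  by move=> /LL' Ln; apply: nL; exists n.
have M1 : (M < `|M| + 1)%R.
  rewrite (Order.POrderTheory.le_lt_trans (Num.Theory.ler_norm M))//.
  by rewrite Num.Theory.ltrDl Num.Theory.ltr01.
have H := hM _ M1.
pose n := Num.bound (`|M| + 1)%R.
have [L Ln] := fills_block_ex n.
have : (`|h L| <= `|M| + 1)%R by exact: H.
rewrite ((hE L).1 n Ln) Num.Theory.normr_nat.
rewrite Order.TotalTheory.leNgt Num.Theory.archi_boundP//.
by rewrite Num.Theory.addr_ge0// Num.Theory.normr_ge0.
Qed.

(** Over each free ultrafilter the complementary set gives a selection different
    from the omitted one. *)
Lemma card_selective : X #= [set: set (set nat)].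
Proof.
rewrite card_eq_le; apply/andP; split.
  apply: (card_le_trans (card_leT X)); apply/pcard_injP.
  by exists betaN_filter => p q _ _; exact: betaN_inj.
have [Psi Psi_inj PsiP] := many_ultrafilters infinite_nat.
pose f Y := bmap (selection (~` xi (Psi Y))) (Psi Y).
have f_inj : injective f.
  by move=> Y Z /(congr1 (bmap block)); rewrite /f !block_selection => /Psi_inj.
apply: (@card_le_trans _ _ _ (range f)).
  have : range f #= [set: set (set nat)] by apply: inj_card_eq => Y Z _ _; exact: f_inj.
  by rewrite card_eq_le => /andP[].
apply: subset_card_le => _ [Y _ <-]; rewrite /X /selective_set /= /f !block_selection.
move=> Pf /(selection_inj Pf) E.
have : xi (Psi Y) 0 <-> ~ xi (Psi Y) 0 by rewrite -[in X in X <-> _]E.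
by case; have [?|?] := pselect (xi (Psi Y) 0); tauto.
Qed.

End selective_hyperspace.

(** * The theorem *)

Lemma distributive_cascade xi :
  (forall t, tame t -> exists2 q, nonprincipal q &
    forall c, (forall s, selective_set xi (t.2 s c)) ->
    forall ms k, selective_set xi (task_limit q t (c, (ms, k)))) ->
  forall (I : Type) n, distributive I -> codable I ->
    cascade_countably_compact n {ptws I -> set_type (selective_set xi)}.
Proof.
move=> xiP I n Id [code code_inj] f.
have [[i0 _]|nI] := pselect (exists i : I, True); last first.
  have [Psi _ /(_ set0)[qf _]] := many_ultrafilters infinite_nat.
  exists (betaN_filter (Psi set0)); split=> //.
  have [||x xl _] := @cascade_ptws I (selective_set xi) (Psi set0) n setT f qf.
  - exact: filterT.
  - by move=> i; exfalso; apply: nI; exists i.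
  by exists x.
have decP c : exists i, forall i', code i' = c -> i' = i.
  have [[i <-]|nc] := pselect (exists i, code i = c).
    by exists i => i' /code_inj.
  by exists i0 => i' ic; exfalso; apply: nc; exists i'.
have [dec decE] := choice decP.
have tt := distributive_tame (fun s i => val (f s i)) dec n Id.
have [q qf qX] := xiP _ tt.
exists (betaN_filter q); split=> //.
have [||x xl _] := @cascade_ptws I (selective_set xi) q n setT f qf.
- exact: filterT.
- move=> i ms k _; have := qX (code i) _ ms k.
  rewrite /task_limit /= -(decE (code i) i erefl); apply=> s.
  exact: set_valP.
by exists x.
Qed.

Theorem corollary7p5 (R : realType) :
  exists X : set betaN,
    [/\ X #= [set: set (set nat)],
        range betaN_of_nat `<=` X,
        (forall (I : Type) (n : nat),
           card_lt [set: I] distributivity_number ->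
           cascade_countably_compact n {ptws I -> set_type X}),
        ~ pseudocompact R (hyperspace (set_type X)) &
        (forall n : nat,
           cascade_countably_compact n {ptws nat -> set_type X})].
Proof.
have [xi xiP] := selective_assignment.
exists (selective_set xi); split.
- exact: card_selective.
- by move=> _ [n _ <-]; exact: selective_of_nat.
- move=> I n Ih; apply: distributive_cascade => //.
    exact: card_lt_distributive.
  exact: card_lt_codable.
- exact: selective_not_pseudocompact.
- move=> n; apply: distributive_cascade => //; first exact: distributive_nat.
  exact: codable_count.
Qed.
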